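(* Let $h:\mathbb{R}^2\to\mathbb{R}$ be positively homogeneous and let $E^*$ be an upper exhauster of $h$ such that $h(u)=\min_{C\in E^*}H(C,u)$ for all $u\in S^1$ (the minimum being attained). Let $C_0\in E^*$ be arbitrary and put $\bar E^*=E^*\setminus\{C_0\}$. Then $\bar E^*$ is also an upper exhauster of $h$ if and only if for every $\theta\in[0,2\pi]$ there exists a set $C_\theta\in\bar E^*$ such that $$\rho_{C_\theta}(\theta)\le\rho_{C_0}(\theta).$$
   Context: A function $h:\mathbb{R}^2\to\mathbb{R}$ is positively homogeneous (of degree one) if $h(\lambda g)=\lambda h(g)$ for all $\lambda\ge 0$ and $g\in\mathbb{R}^2$. A family $E^*$ of nonempty, compact, convex subsets of $\mathbb{R}^2$ is an upper exhauster of $h$ if $h(g)=\inf_{C\in E^*}\max_{v\in C}\langle v,g\rangle$ for all $g\in\mathbb{R}^2$. The support function of a nonempty compact convex set $C$ is $H(C,u)=\max_{v\in C}\langle v,u\rangle$; $S^1$ is the set of unit vectors of $\mathbb{R}^2$. For $\theta\in[0,2\pi]$ put $u_\theta=(\cos\theta,\sin\theta)$ and $\rho_C(\theta)=H(C,u_\theta)=\max_{v\in C}\langle v,u_\theta\rangle$.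
   Formalization: ''Also an upper exhauster'' is taken to include that the minimum over the reduced family is attained and equals h(u) for all u in S^1; with the bare infimum, ''only if'' fails: h=0, E* = all squares [-e,e]^2 with e≥0, C_0={0}. *)

(* Defs.v *)
From mathcomp Require Import all_boot all_order all_algebra.
From mathcomp Require Import all_classical all_reals all_analysis.

Set Implicit Arguments.
Unset Strict Implicit.
Unset Printing Implicit Defensive.

Import Order.TTheory GRing.Theory Num.Theory.
Import numFieldNormedType.Exports.

Local Open Scope classical_set_scope.
Local Open Scope ring_scope.

Definition dot (R : realType) (v g : 'rV[R]_2) : R := \sum_(i < 2) v 0 i * g 0 i.

Definition pos_homogeneous (R : realType) (h : 'rV[R]_2 -> R) : Prop :=
  forall (l : R) (g : 'rV[R]_2), 0 <= l -> h (l *: g) = l * h g.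

Definition convex_body (R : realType) (C : set 'rV[R]_2) : Prop :=
  [/\ C !=set0, compact C & convex_set C].

(* H(C, u) = max_(v in C) <v, u>.  It is only used on nonempty compact sets,
   where the supremum is a maximum by [support_fun_max]. *)
Definition support_fun (R : realType) (C : set 'rV[R]_2) (u : 'rV[R]_2) : R :=
  sup [set dot v u | v in C].

(* The infimum is taken in \bar R: the real-valued [inf] of an empty or
   unbounded set is the junk value 0. *)
Definition upper_exhauster (R : realType) (h : 'rV[R]_2 -> R)
    (E : set (set 'rV[R]_2)) : Prop :=
  (forall C, E C -> convex_body C) /\
  (forall g, (h g)%:E = ereal_inf [set (support_fun C g)%:E | C in E]).

(* The canonical norm of 'rV[R]_2 is the max norm, so the Euclidean unit
   circle is described through [dot]. *)
Definition unit_circle (R : realType) : set 'rV[R]_2 :=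
  [set u | Num.sqrt (dot u u) = 1].

(* h(u) = min_(C in E) H(C, u) for every unit vector u.  This is not implied by
   [upper_exhauster]: the squares [-e, e]^2 with e > 0 form an upper exhauster
   of 0 in which no minimum is attained. *)
Definition min_attained (R : realType) (h : 'rV[R]_2 -> R)
    (E : set (set 'rV[R]_2)) : Prop :=
  forall u, unit_circle u ->
    (exists2 C, E C & support_fun C u = h u) /\
    (forall C, E C -> h u <= support_fun C u).

Definition unit_vec (R : realType) (theta : R) : 'rV[R]_2 :=
  \row_(i < 2) if i == 0 then cos theta else sin theta.

Definition rho (R : realType) (C : set 'rV[R]_2) (theta : R) : R :=
  support_fun C (unit_vec theta).

Lemma dot_continuous (R : realType) (u : 'rV[R]_2) :
  continuous (fun v => dot v u).
Proof.
rewrite /dot; apply: continuous_big => [|i _ v]; first exact: add_continuous.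
apply: (cvgM (f := fun w : 'rV[R]_2 => w 0 i) (g := cst (u 0 i))).
- exact: nbhs_filter.
- exact: coord_continuous.
- by apply: (@cvg_cst _ (u 0 i) _ (nbhs v)); exact: nbhs_filter.
Qed.

Lemma support_fun_max (R : realType) (C : set 'rV[R]_2) (u : 'rV[R]_2) :
  C !=set0 -> compact C ->
  (exists2 v, C v & support_fun C u = dot v u) /\
  (forall v, C v -> dot v u <= support_fun C u).
Proof.
move=> C0 cC.
have cf : {within C, continuous (fun v => dot v u)}.
  by apply: continuous_subspaceT; exact: dot_continuous.
have [c /set_mem Cc maxc] := compact_EVT_max C0 cC cf.
have ubC : ubound [set dot v u | v in C] (dot c u).
  by move=> _ [v Cv <-]; apply: maxc; exact: mem_set.
have supE : support_fun C u = dot c u.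
  apply/eqP; rewrite eq_le; apply/andP; split.
    by apply: ge_sup => //; exists (dot c u), c.
  by apply: ub_le_sup; [exists (dot c u) | exists c].
by split; [exists c | move=> v Cv; rewrite supE; apply: ubC; exists v].
Qed.

(* Main.v *)
Require Import Defs.
From mathcomp Require Import all_boot all_order all_algebra.
From mathcomp Require Import all_classical all_reals all_analysis.

Import Order.TTheory GRing.Theory Num.Theory.
Import numFieldNormedType.Exports.

Local Open Scope classical_set_scope.
Local Open Scope ring_scope.

(** Why the theorem holds.  A set [C] of an exhauster of [h] can only be needed
    in directions where it attains the minimum [h u = H(C, u)].  In such a
    direction [u_theta], where [C0] attains it, a set [C] of [E `\ C0] with
    [rho C theta <= rho C0 theta] attains it as well, because
    [h u_theta <= rho C theta] for every [C] in [E].  So [C0] is dispensable for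
    the minima over the unit circle exactly when such a [C] exists in every
    direction ([min_attained_setD1]); the angles in [0, 2 * pi] do cover the
    circle ([unit_circle_angle]).

    Attained minima on the circle then give the infimum on the whole plane:
    every vector is a nonnegative multiple of a unit vector
    ([polar_decomposition]), and both [h] and the support functions are
    positively homogeneous, so the set attaining the minimum at [u] attains it
    on the whole ray spanned by [u] ([min_attained_upper_exhauster]). *)

Lemma dotZr {R : realType} (r : R) (v g : 'rV[R]_2) :
  dot v (r *: g) = r * dot v g.
Proof. by rewrite /dot mulr_sumr; apply: eq_bigr => i _; rewrite mxE mulrCA. Qed.

Lemma dotZl {R : realType} (r : R) (v g : 'rV[R]_2) :
  dot (r *: v) g = r * dot v g.
Proof. by rewrite /dot mulr_sumr; apply: eq_bigr => i _; rewrite mxE mulrA. Qed.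

Lemma dot_self {R : realType} (g : 'rV[R]_2) :
  dot g g = g 0 0 ^+ 2 + g 0 1 ^+ 2.
Proof.
rewrite /dot big_ord_recl big_ord1 -!expr2.
by congr (_ + g 0 _ ^+ 2); apply: val_inj.
Qed.

Lemma dot_self_ge0 {R : realType} (g : 'rV[R]_2) : 0 <= dot g g.
Proof. by rewrite dot_self addr_ge0 ?sqr_ge0. Qed.

Lemma dot_self_eq0 {R : realType} (g : 'rV[R]_2) : dot g g = 0 -> g = 0.
Proof.
rewrite dot_self => /eqP; rewrite paddr_eq0 ?sqr_ge0// !sqrf_eq0.
move=> /andP[/eqP g0 /eqP g1]; apply/rowP => i; rewrite mxE.
by have [->|->] : i = 0 \/ i = 1
  by case: i => [[|[|//]] ?]; [left | right]; apply: val_inj.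
Qed.

Lemma support_funZ {R : realType} (C : set 'rV[R]_2) (r : R) (u : 'rV[R]_2) :
  convex_body C -> 0 <= r -> support_fun C (r *: u) = r * support_fun C u.
Proof.
move=> [C0 cC _] r0.
have [[v Cv Hv] maxv] := support_fun_max u C0 cC.
have [[w Cw Hw] maxw] := support_fun_max (r *: u) C0 cC.
apply/eqP; rewrite eq_le; apply/andP; split.
  by rewrite Hw dotZr ler_wpM2l// maxv.
by rewrite Hv -dotZr maxw.
Qed.

Lemma unit_circle_unit_vec {R : realType} (theta : R) :
  unit_circle (unit_vec theta).
Proof. by rewrite /unit_circle /= dot_self !mxE cos2Dsin2 sqrtr1. Qed.

(** The arc cosine of the abscissa only covers the closed upper half circle; a
    point of the lower one has the opposite angle, shifted by [2 * pi] to stay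
    nonnegative. *)
Lemma unit_circle_angle {R : realType} (u : 'rV[R]_2) :
  unit_circle u ->
  exists2 theta : R, 0 <= theta <= 2 * pi & u = unit_vec theta.
Proof.
rewrite /unit_circle /= => nu.
have {nu} : dot u u = 1 by rewrite -(sqr_sqrtr (dot_self_ge0 u)) nu expr1n.
rewrite dot_self => nu.
set a := u 0 0 in nu; set b := u 0 1 in nu.
have a_le1 : -1 <= a <= 1.
  by rewrite -ler_norml -(@ler_pXn2r _ 2)// ?nnegrE// expr1n real_normK
    ?num_real// -nu lerDl sqr_ge0.
have sin_a : sin (acos a) = `|b|.
  by rewrite sin_acos// -nu addrAC subrr add0r sqrtr_sqr.
have pi_ge0 := @pi_ge0 R.
have uE theta : cos theta = a -> sin theta = b -> u = unit_vec theta.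
  move=> ca sb; apply/rowP => i; rewrite mxE.
  have [->|->] : i = 0 \/ i = 1
    by case: i => [[|[|//]] ?]; [left | right]; apply: val_inj.
  - by rewrite eqxx ca.
  - by rewrite sb.
have [b0|b0] := leP 0 b.
  exists (acos a); last by apply: uE; rewrite ?acosK// sin_a ger0_norm.
  rewrite acos_ge0//= (le_trans (acos_lepi a_le1))//.
  by rewrite mulr_natl mulr2n lerDl.
exists (2 * pi - acos a).
  rewrite subr_ge0 (le_trans (acos_lepi a_le1))/=; last first.
    by rewrite mulr_natl mulr2n lerDl.
  by rewrite gerBl acos_ge0.
apply: uE; rewrite mulr_natl addrC.
- by rewrite cosD2pi cosN acosK.
- by rewrite sinD2pi sinN sin_a ltr0_norm// opprK.
Qed.

Lemma polar_decomposition {R : realType} (g : 'rV[R]_2) :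
  exists r (u : 'rV[R]_2), [/\ 0 <= r, unit_circle u & g = r *: u].
Proof.
have [/dot_self_eq0 ->|g0] := eqVneq (dot g g) 0.
  (* The zero vector has no direction of its own: any unit vector serves. *)
  exists 0, (unit_vec 0); split=> //; first exact: unit_circle_unit_vec.
  by rewrite scale0r.
have r_gt0 : 0 < Num.sqrt (dot g g) by rewrite sqrtr_gt0 lt0r g0 dot_self_ge0.
exists (Num.sqrt (dot g g)), ((Num.sqrt (dot g g))^-1 *: g); split.
- exact: ltW.
- rewrite /unit_circle /= dotZl dotZr mulrA -expr2 sqrtrM ?sqr_ge0//.
  by rewrite sqrtr_sqr gtr0_norm ?invr_gt0// mulVf ?gt_eqF.
- by rewrite scalerA mulfV ?gt_eqF// scale1r.
Qed.

(** Both sides of the exhauster equation are positively homogeneous, so it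
    propagates from the circle along rays.  At [g = 0] this still uses a set
    attaining the minimum in some direction: it shows that [E] is nonempty, so
    that the infimum is [0] and not [+oo]. *)
Lemma min_attained_upper_exhauster {R : realType} (h : 'rV[R]_2 -> R)
    (E : set (set 'rV[R]_2)) :
  pos_homogeneous h -> (forall C, E C -> convex_body C) ->
  min_attained h E -> upper_exhauster h E.
Proof.
move=> hh bodyE hmin; split=> // g.
have [r [u [r0 u1 ->]]] := polar_decomposition g.
have [[C EC HC] minC] := hmin u u1.
apply/eqP; rewrite eq_le; apply/andP; split.
  apply: le_ereal_inf_tmp => _ [D ED <-].
  by rewrite lee_fin hh// support_funZ ?ler_wpM2l//; [exact: minC | exact: bodyE].
apply: ereal_inf_lbound; exists C => //.
by rewrite hh// support_funZ ?HC//; exact: bodyE.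
Qed.

Lemma min_attained_setD1 {R : realType} (h : 'rV[R]_2 -> R)
    (E : set (set 'rV[R]_2)) (C0 : set 'rV[R]_2) :
  min_attained h E -> E C0 ->
  min_attained h (E `\ C0) <->
  (forall theta : R, 0 <= theta <= 2 * pi ->
     exists2 C, (E `\ C0) C & rho C theta <= rho C0 theta).
Proof.
move=> hmin EC0; split=> [hminD theta _|dominated u u1].
  have u1 := unit_circle_unit_vec theta.
  have [[C EC HC] _] := hminD _ u1.
  by exists C; rewrite // /rho HC; apply: (hmin _ u1).2.
have [[C EC HC] minC] := hmin u u1.
split; last by move=> D [ED _]; exact: minC.
have [CC0|CC0] := pselect (C = C0); last by exists C.
have [theta theta_2pi uE] := unit_circle_angle _ u1.
have [D [ED DC0] rhoD] := dominated theta theta_2pi.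
exists D => //; apply/eqP; rewrite eq_le minC// andbT.
by rewrite -HC CC0 uE.
Qed.

Theorem theorem1 (R : realType) (h : 'rV[R]_2 -> R) (E : set (set 'rV[R]_2))
  (hh : pos_homogeneous h)
  (hE : upper_exhauster h E) (hmin : min_attained h E)
  (C0 : set 'rV[R]_2) (hC0 : E C0) :
  (upper_exhauster h (E `\ C0) /\ min_attained h (E `\ C0)) <->
  (forall theta : R, 0 <= theta <= 2 * pi ->
     exists2 C, (E `\ C0) C & rho C theta <= rho C0 theta).
Proof.
rewrite -(min_attained_setD1 _ _ _ hmin hC0); split=> [[]//|hminD]; split=> //.
by apply: min_attained_upper_exhauster => // C [EC _]; exact: hE.1.
Qed.
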